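(* Take an arbitrary linear code over a finite field $\mathbb{F}$, and consider a sink node of the network, which receives the vector $$\mathbf{Y}=A_1\mathbf{M}_1+A_2\mathbf{M}_2+B_1\mathbf{K}_1+B_2\mathbf{K}_2+G\mathbf{W},$$ knows $\mathbf{K}_1$, and wants to decode $\mathbf{M}_1$. If the average error probability of the sink node is less than $1-1/|\mathbb{F}|$, then the error probability of the sink node has to be zero.
   Context: Setting: a wireline network of source, relay and sink nodes connected by error-free directed links. Nodes may share secret keys, and source and relay nodes may also use private randomness. In a linear code over the finite field $\mathbb{F}$, each message, each shared key and each private randomness variable is a string of independent and uniformly distributed symbols from $\mathbb{F}$, all these variables are mutually independent, and all the coding operations are restricted to taking weighted linear combinations in $\mathbb{F}$. Hence the vector $\mathbf{Y}$ received by a sink node is a linear combination of message, key and private randomness symbols. Here $\mathbf{M}_1$ is the column vector of the messages that the sink wants to decode, $\mathbf{M}_2$ that of all other messages, $\mathbf{K}_1$ that of the secret keys the sink has, $\mathbf{K}_2$ that of the secret keys not shared with the sink, $\mathbf{W}$ that of all private randomness (not known to the sink), and $A_1,A_2,B_1,B_2,G$ are the fixed matrices over $\mathbb{F}$ determined by the code. The error probability of the sink node is the probability that it does not recover $\mathbf{M}_1$ correctly; the average is over the uniform distribution of the messages, keys and private randomness. *)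

(* Defs.v *)
From mathcomp Require Import all_boot all_order all_algebra.

Set Implicit Arguments.
Unset Strict Implicit.
Unset Printing Implicit Defensive.

Import Order.TTheory GRing.Theory Num.Theory.
Local Open Scope ring_scope.

Definition unif_prob (T : finType) (E : pred T) : rat :=
  #|[set x | E x]|%:R / #|T|%:R.

Section Sink.
Variables (F : finFieldType) (m1 m2 k1 k2 w n : nat).

(* Joint values of (M1, M2, K1, K2, W).  The symbols are independent and       *)
(* uniform on F, so their joint law is the uniform law on this product.        *)
Definition outcome : finType :=
  ('cV[F]_m1 * 'cV[F]_m2 * 'cV[F]_k1 * 'cV[F]_k2 * 'cV[F]_w)%type.

Definition M1_ (o : outcome) : 'cV[F]_m1 := o.1.1.1.1.
Definition M2_ (o : outcome) : 'cV[F]_m2 := o.1.1.1.2.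
Definition K1_ (o : outcome) : 'cV[F]_k1 := o.1.1.2.
Definition K2_ (o : outcome) : 'cV[F]_k2 := o.1.2.
Definition W_ (o : outcome) : 'cV[F]_w := o.2.

Definition received (A1 : 'M[F]_(n, m1)) (A2 : 'M[F]_(n, m2))
    (B1 : 'M[F]_(n, k1)) (B2 : 'M[F]_(n, k2)) (G : 'M[F]_(n, w))
    (o : outcome) : 'cV[F]_n :=
  A1 *m M1_ o + A2 *m M2_ o + B1 *m K1_ o + B2 *m K2_ o + G *m W_ o.

(* An arbitrary, not necessarily linear, function of (Y, K1).                  *)
Definition decoder : finType := {ffun 'cV[F]_n * 'cV[F]_k1 -> 'cV[F]_m1}.

Definition linear_decoder (C : 'M[F]_(m1, n)) (D : 'M[F]_(m1, k1)) : decoder :=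
  [ffun yk => C *m yk.1 + D *m yk.2].

Definition decoder_error (Y : outcome -> 'cV[F]_n) (dec : decoder) : rat :=
  unif_prob (fun o => dec (Y o, K1_ o) != M1_ o).

(* The least average error over all decoders; the default value 1 is harmless  *)
(* because every decoder_error is a probability.  A minimum is needed: when    *)
(* M1 is determined by (Y, K1), a nonlinear decoder that errs on just a few    *)
(* values of (Y, K1) still has a small but nonzero error probability.          *)
Definition sink_error (Y : outcome -> 'cV[F]_n) : rat :=
  \big[Num.min/1]_(dec : decoder) decoder_error Y dec.

End Sink.

(* Main.v *)
(* If some vector u of messages, keys and randomness is invisible to the sink
   (Y u = 0, K1 u = 0) but has M1 u <> 0, then any decoder is right on at most
   one point of each line o + F u, so it errs with probability at least
   1 - 1/|F|; otherwise (Y, K1) determines M1.  For a fixed linear decoder the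
   error vector is a linear map L; if L u <> 0 for some u, then L vanishes at
   most once on each line o + F u. *)
Require Import Defs.
From mathcomp Require Import all_boot all_order all_algebra.

Set Implicit Arguments.
Unset Strict Implicit.
Unset Printing Implicit Defensive.

Import Order.TTheory GRing.Theory Num.Theory.
Local Open Scope ring_scope.

Lemma unif_prob_ge0 (T : finType) (E : pred T) : 0 <= unif_prob E.
Proof. by rewrite /unif_prob divr_ge0 ?ler0n. Qed.

Lemma unif_prob_pred0 (T : finType) (E : pred T) :
  E =1 pred0 -> unif_prob E = 0.
Proof.
move=> E0; rewrite /unif_prob (_ : [set x | E x] = set0) ?cards0 ?mul0r //.
by apply/setP=> x; rewrite !inE E0.
Qed.

(** Each point outside [E] claims [#|I|] points of [T], and no point is claimed twice, so the
    complement of [E] has at most [#|T| / #|I|] elements. *)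
Lemma unif_prob_ge_spread (T I : finType) (E : pred T) (f : T -> I -> T) :
    (0 < #|T|)%N -> (0 < #|I|)%N ->
    (forall s t i j, ~~ E s -> ~~ E t -> f s i = f t j -> s = t /\ i = j) ->
  1 - 1 / #|I|%:R <= unif_prob E.
Proof.
move=> T_gt0 I_gt0 f_inj; pose S := [set x | E x].
have leST : (#|~: S| * #|I| <= #|T|)%N.
  rewrite -cardsT -cardsX -(@card_in_imset _ _ (fun p => f p.1 p.2)).
    exact: max_card.
  move=> [s i] [t j]; rewrite !inE !andbT /= => Es Et /(f_inj _ _ _ _ Es Et).
  by case=> -> ->.
have Tp : 0 < #|T|%:R :> rat by rewrite ltr0n.
have Ip : 0 < #|I|%:R :> rat by rewrite ltr0n.
rewrite /unif_prob -/S ler_pdivlMr // mulrBl !mul1r lerBlDr -lerBlDl.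
rewrite -[in X in X - _](cardsC S) natrD addrAC subrr add0r mulrC.
by rewrite ler_pdivlMr // -natrM ler_nat.
Qed.

Section Sink.
Variables (F : finFieldType) (m1 m2 k1 k2 w n : nat).
Variables (A1 : 'M[F]_(n, m1)) (A2 : 'M[F]_(n, m2)).
Variables (B1 : 'M[F]_(n, k1)) (B2 : 'M[F]_(n, k2)) (G : 'M[F]_(n, w)).

Local Notation outcome := (outcome F m1 m2 k1 k2 w).
Local Notation space :=
  ('cV[F]_m1 * 'cV[F]_m2 * 'cV[F]_k1 * 'cV[F]_k2 * 'cV[F]_w)%type.
Local Notation Y := (received A1 A2 B1 B2 G).

(** The casts to the bare product type give access to its vector space operations. *)
Definition shift (u o : outcome) (c : F) : outcome :=
  (o : space) + c *: (u : space).

Lemma M1_shift u o c : M1_ (shift u o c) = M1_ o + c *: M1_ u.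
Proof. by []. Qed.

Lemma K1_shift u o c : K1_ (shift u o c) = K1_ o + c *: K1_ u.
Proof. by []. Qed.

Lemma received_shift u o c : Y (shift u o c) = Y o + c *: Y u.
Proof.
rewrite /received !scalerDr !scalemxAr.
rewrite [LHS](_ : _ = A1 *m (M1_ o + c *: M1_ u) + A2 *m (M2_ o + c *: M2_ u)
  + B1 *m (K1_ o + c *: K1_ u) + B2 *m (K2_ o + c *: K2_ u)
  + G *m (W_ o + c *: W_ u)) //.
rewrite !mulmxDr [RHS]addrACA; congr (_ + _).
by rewrite [RHS]addrACA [X in _ = X + _]addrACA [X in _ = X + _ + _]addrACA.
Qed.

Lemma shift_injl u c : injective (fun o => shift u o c).
Proof. by move=> s t /(@addIr space). Qed.

(** If shifts of two correct outcomes meet, their [L] values agree, so [L u != 0] forces equal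
    coefficients and then equal outcomes. Used with [L] the message [M1_], then with [L] the error
    vector of a linear decoder. *)
Lemma error_ge_of_direction (E : pred outcome) (L : outcome -> 'cV[F]_m1) u :
    L u != 0 -> (forall o c, L (shift u o c) = L o + c *: L u) ->
    (forall s t c d, ~~ E s -> ~~ E t ->
       shift u s c = shift u t d -> L s = L t) ->
  1 - 1 / #|F|%:R <= unif_prob E.
Proof.
move=> Lu0 L_shift L_const; apply: (@unif_prob_ge_spread _ _ _ (shift u)).
- by apply/card_gt0P; exists u.
- by apply/card_gt0P; exists 0.
move=> s t c d Es Et st; have := congr1 L st.
rewrite !L_shift (L_const _ _ _ _ Es Et st) => /addrI /eqP.
rewrite -subr_eq0 -scalerBl scaler_eq0 (negbTE Lu0) orbF subr_eq0 => /eqP cd.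
by move: st; rewrite cd => /shift_injl.
Qed.

(** Shifting along [u] leaves the decoder's input unchanged, so correct outcomes whose shifts meet
    have the same [M1_]. *)
Lemma decoder_error_ge (dec : decoder F m1 k1 n) u :
    Y u = 0 -> K1_ u = 0 -> M1_ u != 0 ->
  1 - 1 / #|F|%:R <= decoder_error Y dec.
Proof.
move=> Yu Ku Mu; apply: (error_ge_of_direction Mu) => // s t c d.
rewrite !negbK => /eqP <- /eqP <- st; congr (dec (_, _)).
  by have := congr1 Y st; rewrite !received_shift Yu !scaler0 !addr0.
by have := congr1 (@K1_ _ _ _ _ _ _) st; rewrite !K1_shift Ku !scaler0 !addr0.
Qed.

Lemma exists_perfect_decoder :
    (forall u, Y u = 0 -> K1_ u = 0 -> M1_ u = 0) ->
  exists dec : decoder F m1 k1 n, decoder_error Y dec = 0.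
Proof.
move=> M1_det.
(* Decode to the message of any outcome consistent with the input; the default 0 only serves pairs
   that never occur. *)
exists [ffun yk => oapp (@M1_ _ _ _ _ _ _) 0
                     [pick o : outcome | (Y o, K1_ o) == yk]].
apply: unif_prob_pred0 => o; apply/negbTE; rewrite negbK ffunE.
case: pickP => [t /eqP [Yt Kt] | /(_ o)]; last by rewrite eqxx.
(* This shift is the difference of [o] and [t], on which [Y] and [K1_] vanish. *)
have := M1_det (shift t o (-1)).
rewrite received_shift K1_shift M1_shift !scaleN1r -Yt -Kt !subrr.
by move=> /(_ erefl erefl) /eqP; rewrite subr_eq0 eq_sym.
Qed.

(** A single wrongly decoded outcome [u] is itself a direction along which the error vector varies,
    while correct outcomes are exactly its zeros. *)
Lemma linear_decoder_error_ge (C : 'M[F]_(m1, n)) (D : 'M[F]_(m1, k1)) u :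
    linear_decoder C D (Y u, K1_ u) != M1_ u ->
  1 - 1 / #|F|%:R <= decoder_error Y (linear_decoder C D).
Proof.
pose L o := linear_decoder C D (Y o, K1_ o) - M1_ o.
rewrite -subr_eq0 => Lu; apply: (@error_ge_of_direction _ L u Lu) => [o c|].
  rewrite /L !ffunE /= received_shift K1_shift M1_shift.
  rewrite (mulmxDr C (Y o)) (mulmxDr D) -!scalemxAr.
  by rewrite scalerBr scalerDr opprD [RHS]addrACA [X in _ = X + _]addrACA.
move=> s t c d; rewrite !negbK -![_ == M1_ _]subr_eq0 => /eqP Ls /eqP Lt _.
by rewrite /L Ls Lt.
Qed.

End Sink.

Theorem theorem2 (F : finFieldType) (m1 m2 k1 k2 w n : nat)
    (A1 : 'M[F]_(n, m1)) (A2 : 'M[F]_(n, m2))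
    (B1 : 'M[F]_(n, k1)) (B2 : 'M[F]_(n, k2)) (G : 'M[F]_(n, w)) :
  let Y := received A1 A2 B1 B2 G in
  (sink_error Y < 1 - 1 / #|F|%:R -> sink_error Y = 0) /\
  (forall (C : 'M[F]_(m1, n)) (D : 'M[F]_(m1, k1)),
     decoder_error Y (linear_decoder C D) < 1 - 1 / #|F|%:R ->
     decoder_error Y (linear_decoder C D) = 0).
Proof.
move=> Y; split=> [|C D].
  case: (pickP (fun u => [&& Y u == 0, K1_ u == 0 & M1_ u != 0])) => [u|no_u].
    case/and3P=> /eqP Yu /eqP Ku Mu; rewrite ltNge => /negP[].
    apply: le_bigmin => [|dec _]; last exact: decoder_error_ge Yu Ku Mu.
    (* The default value 1 of the minimum must respect the bound too. *)
    by rewrite gerBl divr_ge0 ?ler0n.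
  move=> _.
  have [|dec dec0] := @exists_perfect_decoder F _ _ _ _ _ _ A1 A2 B1 B2 G.
    by move=> u Yu Ku; move: (no_u u); rewrite /Y Yu Ku !eqxx => /negbFE/eqP.
  apply/le_anti/andP; split; first by rewrite -dec0; apply: bigmin_le_cond.
  by apply: le_bigmin => // dec' _; apply: unif_prob_ge0.
rewrite ltNge => lt_err; apply: unif_prob_pred0 => u; apply: contraNF lt_err.
exact: linear_decoder_error_ge.
Qed.
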